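(* Suppose the spectral density $f_\theta$ is bounded away from zero and the corresponding autocovariance satisfies $\sum_{r}|r\,c_{f_\theta}(r)|<\infty$. Let $\underline{X}_n=(X_1,\ldots,X_n)'$ be the observed time series and $$\mathcal{L}_{n}(\theta)=n^{-1}\underline{X}_{n}'\Gamma_{n}(f_\theta)^{-1}\underline{X}_{n},\qquad K_{n}(\theta)=n^{-1}\underline{X}_{n}'C_{n}(f_\theta^{-1})\underline{X}_{n}.$$ Then $$\mathcal{L}_{n}(\theta)=\frac{1}{n}\sum_{k=1}^{n}\frac{\widetilde{J}_{n}(\omega_{k,n};f_\theta)\overline{J_{n}(\omega_{k,n})}}{f_\theta(\omega_{k,n})}.$$ Further, $$\Gamma_{n}(f_\theta)^{-1}-C_{n}(f_\theta^{-1})=F_{n}^{*}\Delta_{n}(f_\theta^{-1})D_{n}(f_\theta),$$ and $$\mathcal{L}_{n}(\theta)-K_{n}(\theta)=n^{-1}\underline{X}_{n}'\left[\Gamma_{n}(f_\theta)^{-1}-C_{n}(f_\theta^{-1})\right]\underline{X}_{n}=\frac{1}{n}\sum_{k=1}^{n}\frac{\widehat{J}_{n}(\omega_{k,n};f_\theta)\overline{J_{n}(\omega_{k,n})}}{f_\theta(\omega_{k,n})}.$$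
   Context: Observations are real-valued. For a spectral density $f$ with autocovariance $c_f$, $f(\omega)=\sum_{r\in\mathbb{Z}}c_f(r)e^{ir\omega}$ and $\Gamma_n(f)_{s,t}=c_f(s-t)$ ($n\times n$). $\omega_{k,n}=2\pi k/n$; $(F_n)_{k,t}=n^{-1/2}e^{it\omega_{k,n}}$ ($n\times n$); $\Delta_n(g)=\mathrm{diag}(g(\omega_{1,n}),\ldots,g(\omega_{n,n}))$; $C_n(g)=F_n^*\Delta_n(g)F_n$ is the circulant matrix with entries $C_n(g)_{s,t}=n^{-1}\sum_{k=1}^n g(\omega_{k,n})e^{-i(s-t)\omega_{k,n}}$. $J_n(\omega)=n^{-1/2}\sum_{t=1}^nX_te^{it\omega}$. For $\tau\le 0$ and $\tau>n$, $\{\phi_{t,n}(\tau;f)\}_{t=1}^n$ are the coefficients of the best (in mean square) linear predictor of $X_\tau$ given $X_1,\ldots,X_n$ when the zero mean series has autocovariance $c_f$, and (for the observed $\underline{X}_n$) $\widehat{X}_{\tau,n}=\sum_{t=1}^n\phi_{t,n}(\tau;f)X_t$. Then $$\widehat{J}_n(\omega;f)=n^{-1/2}\sum_{\tau\le0}\widehat{X}_{\tau,n}e^{i\tau\omega}+n^{-1/2}\sum_{\tau>n}\widehat{X}_{\tau,n}e^{i\tau\omega},\qquad \widetilde{J}_n(\omega;f)=J_n(\omega)+\widehat{J}_n(\omega;f),$$ $$D_{n}(f)_{k,t}= n^{-1/2}\sum_{\tau\leq 0}\left(\phi_{t,n}(\tau;f)e^{i\tau\omega_{k,n}}+\phi_{n+1-t,n}(\tau;f)e^{-i(\tau-1)\omega_{k,n}}\right).$$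 *)

(* Defs.v *)
From HB Require Import structures.
From mathcomp Require Import all_boot all_order all_algebra.
From mathcomp Require Import all_classical all_reals all_analysis.
From mathcomp.real_closed Require Import complex.

Set Implicit Arguments.
Unset Strict Implicit.
Unset Printing Implicit Defensive.

Import Order.TTheory GRing.Theory Num.Theory.
Import numFieldNormedType.Exports.

Local Open Scope classical_set_scope.
Local Open Scope ring_scope.
Local Open Scope complex_scope.

(* An index i : 'I_n stands for the time (or frequency number) i.+1, so that
   rows and columns are numbered 1, ..., n. *)

Section InfiniteSums.
Context {R : realType}.

(* The topology on R[i] is that of its norm, carried by the alias R[i]^o. *)
Definition sum_le (m : int) (a : int -> R[i]) : R[i] :=
  limn (series (fun k : nat => a (m - k%:Z)) : nat -> R[i]^o).

Definition sum_gt (m : int) (a : int -> R[i]) : R[i] :=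
  limn (series (fun k : nat => a (m + 1 + k%:Z)) : nat -> R[i]^o).

Definition sumZ (a : int -> R[i]) : R[i] := sum_le 0 a + sum_gt 0 a.

End InfiniteSums.

Section SpectralDensity.
Context {R : realType}.

Definition expi (x : R) : R[i] := cos x +i* sin x.

Definition is_spectral_density (f : R -> R) (c : int -> R) : Prop :=
  forall w : R, (f w)%:C = sumZ (fun r : int => (c r)%:C * expi (r%:~R * w)).

Definition bounded_away_from_zero (f : R -> R) : Prop :=
  exists2 delta : R, 0 < delta & forall w, delta <= f w.

End SpectralDensity.

Definition unobserved (n : nat) : set int :=
  [set tau : int | tau <= 0 \/ n%:Z < tau].

Section Prediction.
Context {d : measure_display} {T : measurableType d} {R : realType}.
Variable P : probability T R.

Definition zero_mean_series (c : int -> R) (Y : int -> {RV P >-> R}) : Prop :=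
  [/\ forall t : int, (Y t : T -> R) \in Lfun P 2%:E,
      forall t : int, ('E_P[Y t] = 0)%E
    & forall s t : int, covariance P (Y s) (Y t) = (c (s - t))%:E].

Definition mean_square_error (Y : int -> {RV P >-> R}) (n : nat) (tau : int)
    (phi : 'cV[R]_n) : \bar R :=
  ('E_P[(fun x : T =>
          ((Y tau x - \sum_(t < n) phi t 0 * Y t.+1%:Z x) ^+ 2)%R)])%E.

Definition best_linear_predictor (Y : int -> {RV P >-> R}) (n : nat)
    (tau : int) (phi : 'cV[R]_n) : Prop :=
  forall psi : 'cV[R]_n,
    (mean_square_error Y tau phi <= mean_square_error Y tau psi)%E.

(* The column vector (phi_{1,n}(tau; f), ..., phi_{n,n}(tau; f)), where f is the
   spectral density of Y; it depends on Y only through the autocovariance.  The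
   value is 0 if no best linear predictor exists. *)
Definition predictor_coef (Y : int -> {RV P >-> R}) (n : nat) (tau : int) :
    'cV[R]_n :=
  xget 0 [set phi : 'cV[R]_n | best_linear_predictor Y tau phi].

End Prediction.

Section Matrices.
Context {R : realType}.
Variable n : nat.

Definition omega (k : 'I_n) : R := 2 * pi * k.+1%:R / n%:R.

Definition rsqrtn : R[i] := ((Num.sqrt n%:R)^-1)%:C.

Definition Gamma (c : int -> R) : 'M[R[i]]_n :=
  \matrix_(s, t) (c (s.+1%:Z - t.+1%:Z))%:C.

Definition Fourier : 'M[R[i]]_n :=
  \matrix_(k, t) (rsqrtn * expi (t.+1%:R * omega k)).

Definition adjoint (A : 'M[R[i]]_n) : 'M[R[i]]_n :=
  map_mx (fun z : R[i] => (z^*)%R) A^T.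

Definition Delta (g : R -> R) : 'M[R[i]]_n :=
  diag_mx (\row_k (g (omega k))%:C).

Definition Circ (g : R -> R) : 'M[R[i]]_n :=
  adjoint Fourier *m Delta g *m Fourier.

Definition quadratic_form (A : 'M[R[i]]_n) (X : 'cV[R]_n) : R[i] :=
  let Xc := map_mx (fun x : R => x%:C) X in (Xc^T *m A *m Xc) 0 0.

Definition gaussian_lik (c : int -> R) (X : 'cV[R]_n) : R[i] :=
  n%:R^-1 * quadratic_form (invmx (Gamma c)) X.

Definition whittle_lik (f : R -> R) (X : 'cV[R]_n) : R[i] :=
  n%:R^-1 * quadratic_form (Circ (fun w => (f w)^-1)) X.

Definition DFT (X : 'cV[R]_n) (w : R) : R[i] :=
  rsqrtn * \sum_(t < n) (X t 0)%:C * expi (t.+1%:R * w).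

End Matrices.

Arguments Fourier {R} n.

Section PredictiveDFT.
Context {d : measure_display} {T : measurableType d} {R : realType}.
Variables (P : probability T R) (Y : int -> {RV P >-> R}) (n : nat).

Definition predicted_obs (X : 'cV[R]_n) (tau : int) : R :=
  \sum_(t < n) predictor_coef Y n tau t 0 * X t 0.

Definition predictive_DFT (X : 'cV[R]_n) (w : R) : R[i] :=
  let a tau := (predicted_obs X tau)%:C * expi (tau%:~R * w) in
  rsqrtn n * sum_le 0 a + rsqrtn n * sum_gt n%:Z a.

Definition complete_DFT (X : 'cV[R]_n) (w : R) : R[i] :=
  DFT X w + predictive_DFT X w.

(* rev_ord maps the index of time t to that of time n + 1 - t. *)
Definition Dmx : 'M[R[i]]_n :=
  \matrix_(k, t)
    (rsqrtn n * sum_le 0 (fun tau : int =>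
       (predictor_coef Y n tau t 0)%:C * expi (tau%:~R * omega k)
       + (predictor_coef Y n tau (rev_ord t) 0)%:C
         * expi (- ((tau - 1)%:~R * omega k)))).

End PredictiveDFT.

(* Main.v *)
Require Import Defs.
From HB Require Import structures.
From mathcomp Require Import all_boot all_order all_algebra.
From mathcomp Require Import all_classical all_reals all_analysis.
From mathcomp.real_closed Require Import complex.
From mathcomp Require Import ring lra zify.

(** Write F for the Fourier matrix, D for the matrix D_n(f) and Gamma for the
    covariance matrix.  Everything rests on the identity
    (F + D) Gamma = Delta(f) F  ([Fourier_Gamma_Dmx]).  Row k of F + D lists,
    for each t, the weight of X_t in the discrete Fourier transform at omega_k
    of the series completed by its best linear predictions: an observed time
    contributes one exponential, an unobserved time tau the coefficient
    phi_t(tau).  Multiplying by Gamma undoes the prediction, because the normal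
    equations say that sum_t c(s - t) phi_t(tau) = c(s - tau)
    ([normal_equations]).  Hence the entry (k, s) of the product is, up to the
    factor n^(-1/2), the sum of c(s - tau) e^(i tau omega_k) over all integers
    tau, and that is e^(i s omega_k) f(omega_k).

    Since F is unitary, the identity inverts to
    Gamma^-1 = F^* Delta(1/f) (F + D).  The part with F is the circulant matrix
    and the part with D is the difference to be computed; the two quadratic
    forms are then read off from F X = J_n and D X = \hat J_n
    ([predictive_DFT_Dmx]).  The definition of D uses times tau <= 0 only.  The
    times tau > n are hidden in its second summand, as reversing time maps the
    predictor of X_tau to that of X_(n+1-tau) ([predictor_coef_reflect]).

    Three facts make these manipulations legitimate.  Gamma is positive
    definite because f stays above a positive constant
    ([toeplitz_form_gt0]): averaging f |sum_t x_t e^(itw)|^2 over a fine grid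
    of frequencies gives the form of Gamma at x, once f has been replaced by a
    truncation of its Fourier series.  The mean square error is therefore a
    strictly convex quadratic function of the coefficients, and
    Gamma^-1 (c(s - tau))_s is its only minimiser
    ([best_linear_predictorP]).  Finally the autocovariance is absolutely
    summable, and with it the predictor coefficients in tau, so that two-sided
    sums may be cut, shifted and combined linearly. *)

Set Implicit Arguments.
Unset Strict Implicit.
Unset Printing Implicit Defensive.

Import Order.TTheory GRing.Theory Num.Theory.
Import numFieldNormedType.Exports.

Local Open Scope classical_set_scope.
Local Open Scope ring_scope.
Local Open Scope complex_scope.

Local Notation Re := complex.Re.
Local Notation Im := complex.Im.

(** * Two-sided sums of complex numbers *)

Section TwoSidedSums.
Context {R : realType}.

Lemma cvg_complex (u : nat -> R[i]) (x y : R) :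
  Re (u n) @[n --> \oo] --> x -> Im (u n) @[n --> \oo] --> y ->
  (u : nat -> R[i]^o) @ \oo --> (x +i* y : R[i]^o).
Proof.
move=> /cvgrPdist_lt ux /cvgrPdist_lt uy; apply/cvgrPdist_lt => -[e e'].
rewrite ltcE /= => /andP[/eqP-> e0].
have e20 : 0 < e / 2 by rewrite divr_gt0.
near=> n.
have -> : (x +i* y : R[i]^o) - u n = (x - Re (u n))%:C + (y - Im (u n))%:C * 'i%C.
  by case: (u n) => a b /=; simpc.
apply: (le_lt_trans (ler_normD _ _)).
rewrite normrM [`|'i%C|]normc_def /= expr0n /= expr1n add0r sqrtr1 mulr1.
rewrite !normc_def /= !expr0n /= !addr0 !sqrtr_sqr -rmorphD /= ltcR.
rewrite [e in _ < e]splitr; apply: ltrD; near: n; [exact: ux|exact: uy].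
Unshelve. all: by end_near. Qed.

Lemma norm_re_im (z : R[i]) (b : R) : `|z| <= b%:C -> `|Re z| <= b /\ `|Im z| <= b.
Proof.
rewrite normc_def lecR => zb; split; apply: le_trans zb.
- by rewrite -sqrtr_sqr ler_sqrt ?addr_ge0 ?sqr_ge0// lerDl sqr_ge0.
- by rewrite -sqrtr_sqr ler_sqrt ?addr_ge0 ?sqr_ge0// lerDr sqr_ge0.
Qed.

Lemma Re_series (a : nat -> R[i]) n : Re (series a n) = series (@Re R \o a) n.
Proof. by rewrite /series /= (raddf_sum (@Re R : Rcomplex R -> R)). Qed.

Lemma Im_series (a : nat -> R[i]) n : Im (series a n) = series (@Im R \o a) n.
Proof. by rewrite /series /= (raddf_sum (@Im R : Rcomplex R -> R)). Qed.

(** Real and imaginary parts reduce the comparison test to the real line, where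
    completeness is at hand. *)
Lemma is_cvg_series_dominated (a : nat -> R[i]) (b : nat -> R) :
  cvgn (series b) -> (forall k, `|a k| <= (b k)%:C) ->
  cvgn (series a : nat -> R[i]^o).
Proof.
move=> cb ab.
have real_part (g : R[i] -> R) : (forall k, `|g (a k)| <= b k) ->
    cvgn (series (g \o a)).
  move=> gb; apply: normed_cvg; apply: (series_le_cvg _ _ _ cb) => k /=.
  - exact: normr_ge0.
  - exact: le_trans (gb k).
  - exact: gb.
have cr := real_part _ (fun k => (norm_re_im (ab k)).1).
have ci := real_part _ (fun k => (norm_re_im (ab k)).2).
apply/cvg_ex; exists (limn (series (@Re R \o a)) +i* limn (series (@Im R \o a))).
apply: cvg_complex.
- under eq_fun do rewrite Re_series; exact: cr.
- under eq_fun do rewrite Im_series; exact: ci.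
Qed.

(** Convergence is asked for at every cut m, so that the property survives
    moving the cut without further argument. *)
Definition sums_converge (a : int -> R[i]) : Prop :=
  (forall m : int, cvgn (series (fun k : nat => a (m - k%:Z)) : nat -> R[i]^o)) /\
  (forall m : int, cvgn (series (fun k : nat => a (m + 1 + k%:Z)) : nat -> R[i]^o)).

(** An injection h of the natural numbers visits each index at most once, hence
    the series along h is bounded by the unordered sum. *)
Lemma summable_inj_cvg (b : int -> R) (h : nat -> int) : injective h ->
  summable [set: int] (EFin \o b) -> cvgn (series (fun k => `|b (h k)|)).
Proof.
move=> hinj sb; apply: nnseries_is_cvg => //.
rewrite nneseries_esumT// -(esum_image setT h (fun r => `|b r|%:E)); last first.
  by move=> x y _ _; exact: hinj.
apply: le_lt_trans sb; rewrite esum_mkcond; apply: le_esum => r _ /=.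
by case: ifP.
Qed.

Lemma dominated_sums_converge (b : int -> R) (a : int -> R[i]) :
  summable [set: int] (EFin \o b) -> (forall r, `|a r| <= `|b r|%:C) ->
  sums_converge a.
Proof.
move=> sb ab; split=> m.
- apply: (is_cvg_series_dominated (b := fun k => `|b (m - k%:Z)|)) => //.
  by apply: summable_inj_cvg sb => x y; lia.
- apply: (is_cvg_series_dominated (b := fun k => `|b (m + 1 + k%:Z)|)) => //.
  by apply: summable_inj_cvg sb => x y; lia.
Qed.

Lemma series_sum (I : finType) (x : I -> R[i]) (a : I -> nat -> R[i]) :
  (forall i, cvgn (series (a i) : nat -> R[i]^o)) ->
  series (fun k => \sum_i x i * a i k) n @[n --> \oo]
    --> (\sum_i x i * limn (series (a i) : nat -> R[i]^o) : R[i]^o).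
Proof.
move=> ca.
have -> : series (fun k => \sum_i x i * a i k) =
    (fun n => \sum_i x i * series (a i) n : R[i]^o).
  apply/funext => n; rewrite /series /= exchange_big /=.
  by apply: eq_bigr => i _; rewrite mulr_sumr.
apply: (@cvg_big R[i]^o) => [|i _]; first exact: add_continuous.
by apply: cvgMl_tmp; exact: ca.
Qed.

Lemma sum_le_sum (I : finType) (x : I -> R[i]) (a : I -> int -> R[i]) m :
  (forall i, sums_converge (a i)) ->
  sum_le m (fun r => \sum_i x i * a i r) = \sum_i x i * sum_le m (a i).
Proof.
move=> ca.
apply: (@cvg_lim R[i]^o) => //.
apply: (series_sum (a := fun i k => a i (m - k%:Z))) => i; exact: (ca i).1.
Qed.

Lemma sum_gt_sum (I : finType) (x : I -> R[i]) (a : I -> int -> R[i]) m :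
  (forall i, sums_converge (a i)) ->
  sum_gt m (fun r => \sum_i x i * a i r) = \sum_i x i * sum_gt m (a i).
Proof.
move=> ca.
apply: (@cvg_lim R[i]^o) => //.
apply: (series_sum (a := fun i k => a i (m + 1 + k%:Z))) => i; exact: (ca i).2.
Qed.

Lemma sum_leD (a b : int -> R[i]) m : sums_converge a -> sums_converge b ->
  sum_le m (fun r => a r + b r) = sum_le m a + sum_le m b.
Proof.
move=> [ca _] [cb _].
apply: (@cvg_lim R[i]^o) => //.
rewrite (_ : (fun k => _) =
  (fun k : nat => a (m - k%:Z)) + (fun k : nat => b (m - k%:Z)))//.
rewrite seriesD; apply: cvgD; [exact: ca|exact: cb].
Qed.

Lemma series_recl (a : nat -> R[i]) : cvgn (series a : nat -> R[i]^o) ->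
  limn (series a : nat -> R[i]^o) =
    a 0%N + limn (series (fun k => a k.+1) : nat -> R[i]^o).
Proof.
move=> ca.
have E : series (fun k => a k.+1) = (fun n => series a n.+1 - a 0%N : R[i]^o).
  apply/funext => n.
  by rewrite /series /= big_nat_recl// addrAC subrr add0r.
have : series (fun k => a k.+1) n @[n --> \oo]
    --> (limn (series a : nat -> R[i]^o) - a 0%N : R[i]^o).
  rewrite E; apply: (@cvgB _ R[i]^o); last exact: (@cvg_cst R[i]^o).
  by rewrite (@cvg_shiftS R[i]^o).
by move=> /(@cvg_lim R[i]^o) ->//; rewrite addrC subrK.
Qed.

Lemma sum_le_recl (a : int -> R[i]) m : sums_converge a ->
  sum_le (m + 1) a = a (m + 1) + sum_le m a.
Proof.
move=> [ca _]; rewrite /sum_le series_recl// subr0.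
suff -> : (fun k : nat => a (m - k%:Z)) = (fun k => a (m + 1 - k.+1%:Z)) by [].
by apply/funext => k; congr a; lia.
Qed.

Lemma sum_gt_recl (a : int -> R[i]) m : sums_converge a ->
  sum_gt m a = a (m + 1) + sum_gt (m + 1) a.
Proof.
move=> [_ ca]; rewrite /sum_gt series_recl// addr0.
suff -> : (fun k : nat => a (m + 1 + 1 + k%:Z)) = (fun k => a (m + 1 + k.+1%:Z)) by [].
by apply/funext => k; congr a; lia.
Qed.

Lemma sumZ_cut (a : int -> R[i]) (m : nat) : sums_converge a ->
  sumZ a = sum_le m%:Z a + sum_gt m%:Z a.
Proof.
move=> ca; elim: m => // m ->; rewrite (sum_gt_recl _ ca) -addn1 PoszD.
by rewrite (sum_le_recl _ ca); ring.
Qed.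

(** Separates the observed times 1, ..., m from the unobserved ones. *)
Lemma sumZ_window (a : int -> R[i]) (m : nat) : sums_converge a ->
  sumZ a = sum_le 0 a + \sum_(t < m) a t.+1%:Z + sum_gt m%:Z a.
Proof.
move=> ca; rewrite (sumZ_cut m ca); congr (_ + _).
elim: m => [|m IH]; first by rewrite big_ord0 addr0.
by rewrite -addn1 PoszD (sum_le_recl _ ca) IH addn1 big_ord_recr /= -addn1 PoszD; ring.
Qed.

Lemma sumZ_shift (a : int -> R[i]) (m : nat) : sums_converge a ->
  sumZ (fun r => a (r + m%:Z)) = sumZ a.
Proof.
move=> ca; rewrite (sumZ_cut m ca) /sumZ /sum_le /sum_gt.
have -> : (fun k : nat => a (m%:Z - k%:Z)) = (fun k => a (0 - k%:Z + m%:Z)).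
  by apply/funext => k; congr a; lia.
suff -> : (fun k : nat => a (m%:Z + 1 + k%:Z)) = (fun k => a (0 + 1 + k%:Z + m%:Z)) by [].
by apply/funext => k; congr a; lia.
Qed.

Lemma sumZM (x : R[i]) (a : int -> R[i]) :
  sums_converge a -> sumZ (fun r => x * a r) = x * sumZ a.
Proof.
move=> ca.
have E : (fun r => x * a r) = (fun r => \sum_(i < 1) x * a r).
  by apply/funext => r; rewrite big_ord1.
rewrite /sumZ E (sum_le_sum (I := 'I_1) (fun=> x) (a := fun=> a))//.
by rewrite (sum_gt_sum (I := 'I_1) (fun=> x) (a := fun=> a))// !big_ord1 mulrDr.
Qed.

End TwoSidedSums.

(** * Exponentials on the unit circle *)

Section UnitCircle.
Context {R : realType}.
Implicit Types x y : R.

Lemma expi0 : expi (0 : R) = 1.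
Proof. by rewrite /expi cos0 sin0. Qed.

Lemma expiD x y : expi (x + y) = expi x * expi y.
Proof. by rewrite /expi cosD sinD; simpc; rewrite [sin x * _ + _]addrC. Qed.

Lemma expiN x : expi (- x) = ((expi x)^*)%R.
Proof. by rewrite /expi cosN sinN. Qed.

Lemma conj_real x : ((x%:C)^*)%R = x%:C.
Proof. exact: conjc_real. Qed.

Lemma expi_normr x : `|expi x| = 1.
Proof. by rewrite normc_def /= cos2Dsin2 sqrtr1. Qed.

Lemma norm_real_expi x y : `|x%:C * expi y| = `|x|%:C.
Proof. by rewrite normrM expi_normr mulr1 normc_def /= expr0n /= addr0 sqrtr_sqr. Qed.

Lemma expiMn x n : expi (n%:R * x) = expi x ^+ n.
Proof.
elim: n => [|n IH]; first by rewrite mul0r expi0.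
by rewrite mulrSr mulrDl mul1r expiD IH exprSr.
Qed.

Lemma expi_2pi n : expi (n%:R * (2 * pi) : R) = 1.
Proof. by rewrite expiMn /expi mulr_natl cos2pi sin2pi expr1n. Qed.

(** With y = |x| / 2 one has cos x = 1 - 2 sin^2 y, and sin y > 0 as y lies
    strictly between 0 and pi. *)
Lemma expi_neq1 x : x != 0 -> `|x| < 2 * pi -> expi x != 1.
Proof.
move=> x0 x2; have y0 : 0 < `|x| / 2 by rewrite divr_gt0 ?normr_gt0.
have ypi : `|x| / 2 < pi by rewrite ltr_pdivrMr// mulrC.
have sy : 0 < sin (`|x| / 2) by rewrite sin_gt0_pi// y0.
have cx : cos x < 1.
  have -> : cos x = cos (`|x| / 2 + `|x| / 2).
    by rewrite -splitr; case: (ger0P x) => // _; rewrite cosN.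
  have : 0 < sin (`|x| / 2) ^+ 2 by rewrite exprn_gt0.
  by rewrite cosD -!expr2 cos2sin2; lra.
by apply/eqP => /(congr1 (@Re R)) /= cx1; rewrite cx1 ltxx in cx.
Qed.

(** The summands are the powers z, z^2, ..., z^N of an N-th root of unity z,
    and the bound on m makes z different from 1 unless m = 0. *)
Lemma sum_expi_omega N (m : int) : `|m| < N%:Z ->
  \sum_(k < N) expi (m%:~R * omega k : R) = (if m == 0 then N%:R else 0).
Proof.
move=> mN; have N0 : (0 < N)%N by lia.
have N0R : (N%:R : R) != 0 by rewrite pnatr_eq0 -lt0n.
have [->|m0] := eqVneq m 0.
  under eq_bigr do rewrite mul0r expi0.
  by rewrite sumr_const card_ord.
pose z := expi (m%:~R * (2 * pi) / N%:R : R).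
have zN : z ^+ N = 1.
  rewrite -expiMn [N%:R * _]mulrC divfK//.
  case: (ger0P m) => [m_ge0|m_lt0].
    by rewrite -(gez0_abs m_ge0) -pmulrn expi_2pi.
  rewrite -[m]opprK -(lez0_abs (ltW m_lt0)) mulrNz mulNr expiN -pmulrn expi_2pi.
  exact: rmorph1.
have z1 : z != 1.
  apply: expi_neq1.
    rewrite !mulf_neq0 ?invr_eq0 ?intr_eq0 ?pnatr_eq0//.
    by rewrite gt_eqF// pi_gt0.
    by rewrite -lt0n.
  rewrite !normrM normfV !normr_nat (ger0_norm (pi_ge0 R)) ltr_pdivrMr ?ltr0n//.
  rewrite [ltRHS]mulrC ltr_pM2r ?mulr_gt0 ?pi_gt0//.
  by rewrite -intr_norm pmulrn ltr_int.
have -> : \sum_(k < N) expi (m%:~R * omega k) = z * \sum_(k < N) z ^+ k.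
  rewrite mulr_sumr; apply: eq_bigr => k _.
  rewrite -exprS -expiMn; congr expi; rewrite /omega; by field.
apply/eqP; rewrite mulf_eq0; apply/orP; right.
have /eqP := subrX1 z N; rewrite zN subrr eq_sym mulf_eq0 subr_eq0.
by rewrite (negPf z1).
Qed.

End UnitCircle.

(** * Positivity of Toeplitz forms *)

Section PositiveDefinite.
Context {R : realType}.

(** The M terms on either side of the cut at 0, that is the indices r with
    - M < r <= M; the shape of the indices matches that of [sumZ]. *)
Definition window_sum (a : int -> R[i]) (M : nat) : R[i] :=
  \sum_(j < M) (a (0 - j%:Z) + a (0 + 1 + j%:Z)).

Lemma window_sum_cvg (a : int -> R[i]) : sums_converge a ->
  (window_sum a : nat -> R[i]^o) @ \oo --> (sumZ a : R[i]^o).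
Proof.
move=> [cl cg].
have -> : window_sum a = (fun M => series (fun k : nat => a (0 - k%:Z)) M
    + series (fun k : nat => a (0 + 1 + k%:Z)) M : R[i]^o).
  by apply/funext => M; rewrite /window_sum /series /= !big_mkord big_split.
by apply: (@cvgD _ R[i]^o); [exact: cl|exact: cg].
Qed.

(** M0 depends on the dominating sequence only.  Applied to
    a r = c(r) e^(irw) it truncates the Fourier series of f uniformly in w. *)
Lemma window_sum_uniform (b : int -> R) (e : R) :
  summable [set: int] (EFin \o b) -> 0 < e ->
  exists M0 : nat, forall (M : nat) (a : int -> R[i]), (M0 <= M)%N ->
    (forall r, `|a r| <= `|b r|%:C) -> `|sumZ a - window_sum a M| < e%:C.
Proof.
move=> sb e0; have e20 : 0 < e / 2 by rewrite divr_gt0.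
pose s k := `|b (0 - k%:Z)| + `|b (0 + 1 + k%:Z)|.
have s0 k : 0 <= s k by rewrite addr_ge0.
have cs : cvgn (series s).
  apply: (is_cvg_seriesD (f := fun k => `|b (0 - k%:Z)|)
    (g := fun k => `|b (0 + 1 + k%:Z)|)).
    by apply: summable_inj_cvg sb => x y; lia.
  by apply: summable_inj_cvg sb => x y; lia.
have /cvgrPdist_lt/(_ _ e20)[M0 _ HM0] := cs.
exists M0 => M a M0M ab.
have ca : sums_converge a by apply: dominated_sums_converge sb _.
(* A further window N is close to the whole sum, and passing from M to N adds
   at most a tail of the dominating series. *)
have /cvgrPdist_lt/(_ (e / 2)%:C) := window_sum_cvg ca.
rewrite ltcR => /(_ e20)[N0 _ HN0].
pose N := maxn N0 M.
have -> : sumZ a - window_sum a M =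
    (sumZ a - window_sum a N) + (window_sum a N - window_sum a M) by ring.
apply: (le_lt_trans (ler_normD _ _)).
rewrite [e in _ < e%:C]splitr rmorphD; apply: ltr_leD.
  by apply: HN0; rewrite /= leq_maxl.
have MN : (M <= N)%N by rewrite leq_maxr.
rewrite /window_sum -!(big_mkord xpredT (fun j => a (0 - j%:Z) + a (0 + 1 + j%:Z))).
rewrite (big_cat_nat (leq0n M) MN)//= addrAC subrr add0r.
apply: (le_trans (ler_norm_sum _ _ _)).
apply: (@le_trans _ _ ((\sum_(M <= j < N) s j)%:C)).
  rewrite rmorph_sum; apply: ler_sum => j _.
  rewrite rmorphD /=; apply: (le_trans (ler_normD _ _)).
  by apply: lerD; exact: ab.
rewrite lecR; have -> : \sum_(M <= j < N) s j = series s N - series s M.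
  by rewrite sub_series_geq.
have nds : nondecreasing_seq (series s) by apply: nondecreasing_series.
have := nondecreasing_cvgn_le nds cs N.
have := HM0 M M0M; rewrite /= ltr_norml => /andP[_].
set L := limn _; set u := series s N; set v := series s M.
by lra.
Qed.

Lemma window_sum_single (a : int -> R[i]) (M : nat) (d : int) : `|d| < M%:Z ->
  window_sum (fun r => if r == d then a r else 0) M = a d.
Proof.
move=> dM; rewrite /window_sum big_split /=.
have [d0|d0] := lerP d 0.
- have dM' : (`|d| < M)%N by lia.
  rewrite (bigD1 (Ordinal dM')) //= ifT; last by lia.
  rewrite !big1 ?addr0 => [||j jd]; first by congr a; lia.
    by move=> j _; rewrite ifF//; lia.
  rewrite ifF//; apply/negbTE; apply: contraNneq jd => jd.
  by apply/eqP/val_inj => /=; lia.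
- have dM' : (`|d|.-1 < M)%N by lia.
  rewrite addrC (bigD1 (Ordinal dM')) //= ifT; last by lia.
  rewrite !big1 ?addr0 => [||j jd]; first by congr a; lia.
    by move=> j _; rewrite ifF//; lia.
  rewrite ifF//; apply/negbTE; apply: contraNneq jd => jd.
  by apply/eqP/val_inj => /=; lia.
Qed.

Definition trig_sum n (x : 'I_n -> R) (w : R) : R[i] :=
  \sum_t (x t)%:C * expi (t.+1%:R * w).

(** Expanding the squared modulus gives the exponentials of (r - (s - t)) omega
    with |r - (s - t)| < M + n < N.  By orthogonality on the grid of N points
    only r = s - t is left, and this lag lies in the window because n <= M. *)
Lemma toeplitz_form_grid (b : int -> R) n M N (x : 'I_n -> R) :
  (n <= M)%N -> (M + n < N)%N ->
  \sum_(k < N) window_sum (fun r => (b r)%:C * expi (r%:~R * omega k)) M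
      * (trig_sum x (omega k) * (trig_sum x (omega k))^*)
    = (N%:R * \sum_s \sum_t x s * x t * b (s.+1%:Z - t.+1%:Z))%:C.
Proof.
move=> nM MN.
have -> : \sum_(k < N) window_sum (fun r => (b r)%:C * expi (r%:~R * omega k)) M
      * (trig_sum x (omega k) * (trig_sum x (omega k))^*) =
  \sum_s \sum_t (x s * x t)%:C * window_sum (fun r => (b r)%:C *
     \sum_(k < N) expi ((r - (s.+1%:Z - t.+1%:Z))%:~R * omega k)) M.
  pose F r (s t : 'I_n) (k : 'I_N) := (x s * x t)%:C * ((b r)%:C *
     expi ((r - (s.+1%:Z - t.+1%:Z))%:~R * omega k)).
  transitivity (\sum_(k < N) \sum_s \sum_t \sum_(j < M)
      (F (0 - j%:Z) s t k + F (0 + 1 + j%:Z) s t k)).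
    apply: eq_bigr => k _.
    have -> : trig_sum x (omega k) * (trig_sum x (omega k))^* = \sum_s \sum_t
        ((x t)%:C * expi (t.+1%:R * omega k) * ((x s)%:C * expi (s.+1%:R * omega k))^*).
      by rewrite /trig_sum rmorph_sum /= big_distrlr exchange_big.
    rewrite mulr_sumr; apply: eq_bigr => s _; rewrite mulr_sumr; apply: eq_bigr => t _.
    rewrite /window_sum mulr_suml; apply: eq_bigr => j _.
    have E r : (b r)%:C * expi (r%:~R * omega k) * ((x t)%:C * expi (t.+1%:R * omega k)
        * ((x s)%:C * expi (s.+1%:R * omega k))^*) = F r s t k.
      rewrite rmorphM /= conj_real -expiN.
      rewrite /F rmorphM /=.
      rewrite (_ : (r - (s.+1%:Z - t.+1%:Z))%:~R * omega k =
        r%:~R * omega k + t.+1%:R * omega k + - (s.+1%:R * omega k)); last first.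
        by rewrite !rmorphB /=; ring.
      by rewrite !expiD; ring.
    by rewrite mulrDl !E.
  rewrite exchange_big /=; apply: eq_bigr => s _.
  rewrite exchange_big /=; apply: eq_bigr => t _.
  rewrite exchange_big /= /window_sum mulr_sumr; apply: eq_bigr => j _.
  by rewrite big_split /= mulrDr !mulr_sumr.
rewrite mulr_sumr rmorph_sum; apply: eq_bigr => s _.
rewrite mulr_sumr rmorph_sum; apply: eq_bigr => t _ /=.
have dn : `|s.+1%:Z - t.+1%:Z| < n%:Z by have := ltn_ord s; have := ltn_ord t; lia.
set d := (s.+1%:Z - t.+1%:Z) in dn *.
have st : `|d| < M%:Z by lia.
have -> : window_sum (fun r => (b r)%:C *
     \sum_(k < N) expi ((r - d)%:~R * omega k)) M = (N%:R * b d)%:C.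
  rewrite -(window_sum_single (fun r => (N%:R * b r)%:C) st).
  have E r : `|r - d| < N%:Z -> (b r)%:C * \sum_(k < N) expi ((r - d)%:~R * omega k)
      = if r == d then (N%:R * b r)%:C else 0.
    move=> rdN; rewrite sum_expi_omega// subr_eq0; case: ifP => _; last by rewrite mulr0.
    by rewrite mulrC rmorphM rmorph_nat.
  by apply: eq_bigr => j _; have := ltn_ord j => jM; rewrite !E//; lia.
by rewrite -rmorphM /= -mulrCA.
Qed.

(** The truncated Fourier series keeps the lower bound delta / 2.  The grid
    identity for c then bounds the form below by delta / 2 times the same
    identity for the sequence that is 1 at 0 and 0 elsewhere, and the latter
    is the sum of the squares of x. *)
Lemma toeplitz_form_gt0 (f : R -> R) (c : int -> R) n (x : 'I_n -> R) :
  is_spectral_density f c -> bounded_away_from_zero f ->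
  summable [set: int] (EFin \o c) -> (exists t, x t != 0) ->
  0 < \sum_s \sum_t x s * x t * c (s.+1%:Z - t.+1%:Z).
Proof.
move=> fc [delta d0 fd] sc [t0 xt0].
have d20 : 0 < delta / 2 by rewrite divr_gt0.
have [M0 HM0] := window_sum_uniform sc d20.
pose M := maxn M0 n.+1; pose N := (M + n).+1.
have N0 : (0 < N%:R :> R) by rewrite ltr0n.
pose A k := window_sum (fun r => (c r)%:C * expi (r%:~R * omega (k : 'I_N))) M.
have A_ge k : delta / 2 <= Re (A k).
  have := HM0 M (fun r => (c r)%:C * expi (r%:~R * omega k)) (leq_maxl _ _).
  rewrite -fc => /(_ _)/ltW/norm_re_im[].
    by move=> r; rewrite norm_real_expi.
  rewrite -/(A k) raddfB /= ler_norml => /andP[_ +] _; have := fd (omega k).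
  by lra.
pose q k := Re (trig_sum x (omega (k : 'I_N))) ^+ 2
  + Im (trig_sum x (omega k)) ^+ 2.
have qE k : trig_sum x (omega k) * (trig_sum x (omega k))^* = (q k)%:C.
  by rewrite -normCK -add_Re2_Im2.
have nM : (n <= M)%N by rewrite /M; lia.
have hc := toeplitz_form_grid c x nM (leqnn N).
have h1 := toeplitz_form_grid (fun r => (r == 0)%:R) x nM (leqnn N).
have sum_q : \sum_k q k = N%:R * \sum_t x t ^+ 2.
  apply: complexI; rewrite rmorph_sum -[in RHS](_ : \sum_s \sum_t x s * x t *
      (s.+1%:Z - t.+1%:Z == 0)%:R = \sum_t x t ^+ 2).
    rewrite -h1; apply: eq_bigr => k _ /=; rewrite qE.
    rewrite -[LHS]mul1r; congr (_ * _).
    have M_gt0 : `|0 : int| < M%:Z by rewrite normr0 ltz_nat /M; lia.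
    rewrite -(window_sum_single (fun=> 1) M_gt0).
    apply: eq_bigr => j _; congr (_ + _).
      by case: eqP => [->|]; rewrite ?mul0r ?expi0 ?mulr1.
    by rewrite (_ : (0 + 1 + j%:Z == 0) = false) ?mul0r//; lia.
  apply: eq_bigr => s _; rewrite (bigD1 s)//= subrr eqxx mulr1 big1 ?addr0 -?expr2//.
  move=> t ts; rewrite subr_eq0 eqz_nat eqSS [s == t :> nat]eq_sym.
  by rewrite (negPf ts : (t == s :> nat) = false) mulr0.
have : N%:R * \sum_s \sum_t x s * x t * c (s.+1%:Z - t.+1%:Z) =
    \sum_k Re (A k) * q k.
  have := congr1 (@Re R) hc => /= <-.
  rewrite (raddf_sum (@Re R : Rcomplex R -> R)); apply: eq_bigr => k _ /=.
  by rewrite qE -/(A k); case: (A k) => u v /=; rewrite mulr0 subr0.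
move=> Nq; rewrite -(pmulr_rgt0 _ N0) Nq.
apply: (@lt_le_trans _ _ (\sum_k (delta / 2) * q k)).
  rewrite -mulr_sumr sum_q !mulr_gt0// (bigD1 t0)//= ltr_pwDl//.
    by rewrite exprn_even_gt0.
  by apply: sumr_ge0 => t _; exact: sqr_ge0.
by apply: ler_sum => k _; rewrite ler_wpM2r// addr_ge0 ?sqr_ge0.
Qed.

End PositiveDefinite.

(** * Best linear prediction *)

Section Autocovariance.
Context {R : realType}.
Variables (c : int -> R) (n : nat).

Definition acov : 'M[R]_n := \matrix_(s, t) c (s.+1%:Z - t.+1%:Z).

Definition lag_acov (tau : int) : 'cV[R]_n := \col_s c (s.+1%:Z - tau).

Lemma Gamma_acov : Gamma n c = map_mx (real_complex R) acov.
Proof. by apply/matrixP => s t; rewrite !mxE. Qed.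

Lemma acov_form (x : 'cV[R]_n) : (x^T *m acov *m x) 0 0 =
  \sum_s \sum_t x s 0 * x t 0 * c (s.+1%:Z - t.+1%:Z).
Proof.
rewrite !mxE exchange_big /=; apply: eq_bigr => t _; rewrite !mxE mulr_suml.
by apply: eq_bigr => s _; rewrite !mxE; ring.
Qed.

Definition positive_definite (A : 'M[R]_n) : Prop :=
  forall x : 'cV[R]_n, x != 0 -> 0 < (x^T *m A *m x) 0 0.

Lemma positive_definite_unit (A : 'M[R]_n) : positive_definite A -> A \in unitmx.
Proof.
move=> pdA; rewrite unitmxE unitfE; apply/negP => /det0P[v v0 vA].
by have := pdA v^T; rewrite trmx_eq0 v0 trmxK vA mul0mx mxE ltxx => /(_ isT).
Qed.

End Autocovariance.

Lemma acov_positive_definite (R : realType) (f : R -> R) (c : int -> R) n :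
  is_spectral_density f c -> bounded_away_from_zero f ->
  summable [set: int] (EFin \o c) -> positive_definite (acov c n).
Proof.
move=> fc f_bounded sc x /eqP x0; rewrite acov_form.
apply: (toeplitz_form_gt0 fc) => //; apply/not_existsP => x_eq0.
by apply: x0; apply/colP => t; rewrite mxE; apply/eqP/negPn/negP/x_eq0.
Qed.

Section BestPrediction.
Context {d : measure_display} {T : measurableType d} {R : realType}.
Variables (P : probability T R) (Y : int -> {RV P >-> R}) (c : int -> R).
Hypothesis Y_series : zero_mean_series c Y.
Variable n : nat.

Lemma acov_even r : c (- r) = c r.
Proof.
have [_ _ cov] := Y_series; apply: EFin_inj.
have := cov 0 r; rewrite covarianceC cov sub0r subr0 => ->//.
Qed.

Lemma acov_sym : (acov c n)^T = acov c n.
Proof. by apply/matrixP => s t; rewrite !mxE -acov_even opprB. Qed.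

Lemma second_moment s t : ('E_P[(Y s : T -> R) \* (Y t : T -> R)] = (c (s - t))%:E)%E.
Proof.
have [L2 EY cov] := Y_series.
have L1 u : (Y u : T -> R) \in Lfun P 1.
  by apply: Lfun_subset12; [exact: fin_num_measure|exact: L2].
rewrite -cov covarianceE//; last exact: Lfun2_mul_Lfun1.
by rewrite !EY mule0 sube0.
Qed.

Lemma expectation_fsum (I : finType) (F : I -> T -> R) :
  (forall i, F i \in Lfun P 1) ->
  ('E_P[(fun x => \sum_i F i x)%R] = \sum_i 'E_P[F i])%E.
Proof.
move=> L1F; rewrite -(big_map F xpredT (fun X => 'E_P[X])%E) -expectation_sum.
  by congr expectation; apply/funext => x; rewrite big_map fct_sumE.
by move=> _ /mapP[i _ ->].
Qed.

Lemma expectation_sqr_sum (I : finType) (a : I -> R) (u : I -> int) :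
  ('E_P[(fun x => (\sum_i a i * Y (u i) x) ^+ 2)%R] =
    (\sum_i \sum_j a i * a j * c (u i - u j))%R%:E)%E.
Proof.
have [L2 _ _] := Y_series.
have L1 i j : (a i * a j) \o* ((Y (u i) : T -> R) \* Y (u j)) \in Lfun P 1.
  by apply: Lfun_scale => //; exact: Lfun2_mul_Lfun1.
have -> : (fun x => (\sum_i a i * Y (u i) x) ^+ 2) = (fun x => \sum_i \sum_j
    ((a i * a j) \o* ((Y (u i) : T -> R) \* Y (u j))) x).
  apply/funext => x; rewrite expr2 big_distrlr; apply: eq_bigr => i _.
  by apply: eq_bigr => j _ /=; ring.
rewrite expectation_fsum => [|i]; last first.
  rewrite (_ : (fun x => _) = \sum_j (a i * a j) \o* ((Y (u i) : T -> R) \* Y (u j))).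
    by apply: rpred_sum.
  by apply/funext => x; rewrite fct_sumE.
rewrite -sumEFin; apply: eq_bigr => i _; rewrite expectation_fsum// -sumEFin.
apply: eq_bigr => j _; rewrite expectationZl ?second_moment//.
exact: Lfun2_mul_Lfun1.
Qed.

Lemma mean_square_errorE tau (phi : 'cV[R]_n) :
  mean_square_error Y tau phi = (c 0 - 2 * (phi^T *m lag_acov c n tau) 0 0
    + (phi^T *m acov c n *m phi) 0 0)%:E.
Proof.
(* The prediction error is one linear combination of n + 1 variables: index 0
   is the predicted one, with coefficient 1. *)
pose a (i : 'I_n.+1) := if unlift ord0 i is Some t then - phi t 0 else 1.
pose u (i : 'I_n.+1) := if unlift ord0 i is Some t then t.+1%:Z else tau.
have a0 : a ord0 = 1 by rewrite /a unlift_none.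
have u0 : u ord0 = tau by rewrite /u unlift_none.
have aS t : a (lift ord0 t) = - phi t 0 by rewrite /a liftK.
have uS t : u (lift ord0 t) = t.+1%:Z by rewrite /u liftK.
rewrite /mean_square_error.
have -> : (fun x => (Y tau x - \sum_(t < n) phi t 0 * Y t.+1%:Z x) ^+ 2) =
    (fun x => (\sum_i a i * Y (u i) x) ^+ 2).
  apply/funext => x; rewrite big_ord_recl a0 u0 mul1r; congr ((_ + _) ^+ 2).
  by rewrite -sumrN; apply: eq_bigr => t _; rewrite aS uS mulNr.
rewrite expectation_sqr_sum; congr (_%:E).
rewrite big_ord_recl big_ord_recl a0 u0 subrr !mul1r -!addrA; congr (_ + _).
have bE : (phi^T *m lag_acov c n tau) 0 0 = \sum_t phi t 0 * c (t.+1%:Z - tau).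
  by rewrite mxE; apply: eq_bigr => t _; rewrite !mxE.
under eq_bigr do rewrite aS uS mul1r -acov_even opprB mulNr.
under [X in _ + X]eq_bigr => i _.
  rewrite aS uS big_ord_recl a0 u0 mulr1 mulNr.
  under eq_bigr do rewrite aS uS mulrNN.
  over.
by rewrite big_split /= !sumrN -bE acov_form; ring.
Qed.

(** Completing the square: the error at psi exceeds that at the solution of the
    normal equations by the form of [acov] at the difference of the two. *)
Lemma best_linear_predictorP tau (phi : 'cV[R]_n) :
  positive_definite (acov c n) ->
  best_linear_predictor Y tau phi <-> phi = invmx (acov c n) *m lag_acov c n tau.
Proof.
move=> pd; have Gu := positive_definite_unit pd.
set G := acov c n in pd Gu *; set b := lag_acov c n tau.
pose q (x : 'cV[R]_n) := c 0 - 2 * (x^T *m b) 0 0 + (x^T *m G *m x) 0 0.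
have qE psi : q psi = q (invmx G *m b) +
    ((psi - invmx G *m b)^T *m G *m (psi - invmx G *m b)) 0 0.
  set phi0 := invmx G *m b.
  have bE : b = G *m phi0 by rewrite mulKVmx.
  have sw (x y : 'cV[R]_n) : (x^T *m G *m y) 0 0 = (y^T *m G *m x) 0 0.
    have -> : x^T *m G *m y = (y^T *m G *m x)^T.
      by rewrite !trmx_mul trmxK acov_sym mulmxA.
    by rewrite mxE.
  have [y ->] : exists y, psi = phi0 + y by exists (psi - phi0); rewrite addrC subrK.
  rewrite [phi0 + y - phi0]addrAC subrr add0r.
  move: phi0 bE => phi0 bE; rewrite /q bE [(phi0 + y)^T]linearD /=.
  rewrite !mulmxDl !mulmxDr !mulmxA [LHS]/=.
  have mxD (A B : 'M[R]_1) : (A + B) 0 0 = A 0 0 + B 0 0 by rewrite mxE.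
  by rewrite !mxD (sw phi0 y); ring.
have mseE psi : mean_square_error Y tau psi = (q psi)%:E by exact: mean_square_errorE.
split=> [best|->].
- apply/eqP; rewrite -subr_eq0; apply/negPn/negP => /pd.
  have := best (invmx G *m b); rewrite !mseE lee_fin qE.
  by lra.
- move=> psi; rewrite !mseE lee_fin (qE psi) lerDl.
  have [->|/pd/ltW//] := eqVneq (psi - invmx G *m b) 0.
  by rewrite mulmx0 mxE.
Qed.

Lemma predictor_coefE tau : positive_definite (acov c n) ->
  predictor_coef Y n tau = invmx (acov c n) *m lag_acov c n tau.
Proof.
move=> pd; rewrite /predictor_coef.
case: xgetP => [phi _ /best_linear_predictorP->//|no_predictor].
by case: (no_predictor (invmx (acov c n) *m lag_acov c n tau)); apply/best_linear_predictorP.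
Qed.

End BestPrediction.

(** * Absolute summability over the integers *)

Section Summability.
Context {R : realType}.

Lemma summableZ (b : int -> R) (x : R) :
  summable [set: int] (EFin \o b) -> summable [set: int] (fun r => (x * b r)%:E).
Proof.
rewrite /summable => sb.
apply: (@le_lt_trans _ _ (`|x|%:E * \esum_(r in [set: int]) `|(b r)%:E|)%E); last first.
  by rewrite lte_mul_pinfty ?lee_fin.
apply: ge_ereal_sup => _ [A finA <-].
rewrite (eq_fsbigr (fun r => (`|x|%:E * `|(b r)%:E|)%E)); last first.
  by move=> r _; rewrite EFinM abseM.
rewrite -ge0_mule_fsumr//.
by apply: lee_wpmul2l; [rewrite lee_fin|apply: ereal_sup_ubound; exists A].
Qed.

Lemma summable_reflect (b : int -> R) (m : int) :
  summable [set: int] (EFin \o b) -> summable [set: int] (fun r => (b (m - r))%:E).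
Proof.
rewrite /summable (reindex_esum setT setT (fun r => m - r))//.
split=> // [x y _ _|y _]; first by lia.
by exists (m - y) => //; lia.
Qed.

Lemma summable_fsum (I : finType) (b : I -> int -> R) :
  (forall i, summable [set: int] (EFin \o b i)) ->
  summable [set: int] (fun r => (\sum_i b i r)%:E).
Proof.
move=> sb; elim: (index_enum I) => [|i r IH].
  rewrite /summable esum1 ?ltry// => r _.
  by rewrite big_nil abse0.
rewrite (_ : (fun k => _) = (EFin \o b i) \+ (fun k => (\sum_(j <- r) b j k)%:E)).
  exact: summableD.
by apply/funext => k; rewrite big_cons EFinD.
Qed.

(** The weight vanishes at r = 0, so the single term |c 0| has to be added back;
    elsewhere |c r| <= |r c r|. *)
Lemma summable_acov (c : int -> R) :
  (\esum_(r in [set: int]) (`|r%:~R * c r|)%:E < +oo)%E ->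
  summable [set: int] (EFin \o c).
Proof.
move=> rc; pose c0 (r : int) := if r \in [set 0] then `|c r|%:E else 0%E.
have s0 : summable [set: int] c0.
  rewrite /summable (eq_esum (b := c0)).
    by rewrite -esum_mkcond esum_set1 ?ltry.
  by move=> r _; rewrite /c0; case: ifP => _; rewrite ?abse0//= normr_id.
have s1 : summable [set: int] (fun r => (r%:~R * c r)%:E) by [].
apply: le_lt_trans (summableD s1 s0); apply: le_esum => r _; rewrite /c0 /=.
have [->|r0] := eqVneq r 0.
  by rewrite mem_set//= mul0r add0r normr_id.
rewrite memNset ?adde0 /=; last by move=> /eqP; rewrite (negPf r0).
rewrite lee_fin normrM ler_peMl// -intr_norm (ler1z _ ).
by lia.
Qed.

End Summability.

(** * The Fourier matrix *)

Section FourierMatrix.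
Context {R : realType}.
Variables (n : nat).
Implicit Types (g : R -> R) (X : 'cV[R]_n).

Lemma rsqrtn_sqr : rsqrtn n * rsqrtn n = n%:R^-1 :> R[i].
Proof.
rewrite /rsqrtn -rmorphM /= -invfM -expr2 sqr_sqrtr ?ler0n//.
by rewrite fmorphV rmorph_nat.
Qed.

Lemma expi_omega_period (k : 'I_n) : expi (n%:R * omega k : R) = 1.
Proof.
rewrite -(expi_2pi k.+1); congr expi; rewrite /omega.
by field; rewrite pnatr_eq0 -lt0n (leq_ltn_trans _ (ltn_ord k)).
Qed.

Lemma Fourier_unitary : adjoint (Fourier n) *m Fourier n = 1%:M :> 'M[R[i]]_n.
Proof.
apply/matrixP => s t; rewrite !mxE.
have E (k : 'I_n) : adjoint (Fourier n) s k * Fourier n k t =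
    n%:R^-1 * expi ((t%:Z - s%:Z)%:~R * omega k) :> R[i].
  rewrite !mxE rmorphM /= conj_real -expiN mulrACA rsqrtn_sqr -expiD.
  congr (_ * expi _); rewrite rmorphB /=; rewrite -!pmulrn -!natr1; ring.
under eq_bigr do rewrite E.
rewrite -mulr_sumr sum_expi_omega; last first.
  by have := ltn_ord s; have := ltn_ord t; lia.
rewrite subr_eq0 eqz_nat eq_sym -[(s : nat) == t]/(s == t); case: (s == t).
  by rewrite mulVf ?eqxx// pnatr_eq0 -lt0n (leq_ltn_trans _ (ltn_ord s)).
by rewrite mulr0.
Qed.

Lemma mulmx_Fourier X (k : 'I_n) :
  (Fourier n *m map_mx (fun x => x%:C) X) k 0 = DFT X (omega k).
Proof.
rewrite mxE /DFT mulr_sumr; apply: eq_bigr => t _.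
by rewrite !mxE; ring.
Qed.

Lemma quadratic_form_Fourier g (B : 'M[R[i]]_n) X :
  quadratic_form (adjoint (Fourier n) *m Delta n g *m B) X =
  \sum_k (B *m map_mx (fun x => x%:C) X) k 0 * ((DFT X (omega k))^*)%R * (g (omega k))%:C.
Proof.
rewrite /quadratic_form; set Xc := map_mx _ X.
have FX k : (Xc^T *m adjoint (Fourier n)) 0 k = ((DFT X (omega k))^*)%R.
  rewrite -mulmx_Fourier !mxE rmorph_sum; apply: eq_bigr => t _.
  by rewrite !mxE !rmorphM /= !conj_real; ring.
rewrite !mulmxA -[_ *m B *m Xc]mulmxA mxE; apply: eq_bigr => k _.
by rewrite /Delta mul_mx_diag mxE FX mxE; ring.
Qed.

Lemma DeltaV f : (forall w, f w != 0) ->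
  Delta n (fun w => (f w)^-1) *m Delta n f = 1%:M :> 'M[R[i]]_n.
Proof.
move=> f0; rewrite /Delta mulmx_diag -diag_const_mx; congr diag_mx.
by apply/rowP => k; rewrite !mxE -rmorphM /= mulVf// f0.
Qed.

End FourierMatrix.

(** * Predictor coefficients and the completed Fourier transform *)

Section Predictors.
Context {d : measure_display} {T : measurableType d} {R : realType}.
Variables (P : probability T R) (Y : int -> {RV P >-> R}) (c : int -> R).
Variable n : nat.
Hypothesis Y_series : zero_mean_series c Y.
Hypothesis c_summable : summable [set: int] (EFin \o c).
Hypothesis acov_pd : positive_definite (acov c n).

Local Notation phi := (predictor_coef Y n).

Lemma normal_equations tau (s : 'I_n) :
  \sum_(t < n) c (s.+1%:Z - t.+1%:Z) * phi tau t 0 = c (s.+1%:Z - tau).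
Proof.
have : acov c n *m phi tau = lag_acov c n tau.
  by rewrite (predictor_coefE Y_series)// mulKVmx// positive_definite_unit.
move=> /matrixP/(_ s 0); rewrite !mxE => <-.
by apply: eq_bigr => t _; rewrite !mxE.
Qed.

Lemma predictor_coef_summable (t : 'I_n) :
  summable [set: int] (fun tau => (phi tau t 0)%:E).
Proof.
rewrite (_ : (fun tau => _) = (fun tau =>
    (\sum_s invmx (acov c n) t s * c (s.+1%:Z - tau))%:E)).
  apply: (summable_fsum (b := fun s tau => invmx (acov c n) t s * c (s.+1%:Z - tau))).
  by move=> s; apply: (summableZ (b := fun r => c (s.+1%:Z - r))); exact: summable_reflect.
apply/funext => tau; rewrite (predictor_coefE Y_series)// mxE.
by congr EFin; apply: eq_bigr => s _; rewrite !mxE.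
Qed.

(** Reversing time turns the equations for X_tau into those for X_(n+1-tau),
    since c is even; uniqueness of their solution does the rest. *)
Lemma predictor_coef_reflect tau (t : 'I_n) :
  phi (n%:Z + 1 - tau) t 0 = phi tau (rev_ord t) 0.
Proof.
pose psi := \col_t phi tau (rev_ord t) 0.
suff -> : phi (n%:Z + 1 - tau) = psi by rewrite mxE.
rewrite (predictor_coefE Y_series)//.
apply: (canLR (mulKmx (positive_definite_unit acov_pd))); apply/colP => s.
rewrite !mxE -(acov_even Y_series) (_ : - _ = (rev_ord s).+1%:Z - tau); last first.
  by rewrite /=; have := ltn_ord s; lia.
rewrite -normal_equations (reindex_inj rev_ord_inj) /=; apply: eq_bigr => t' _.
rewrite !mxE -(acov_even Y_series); congr (c _ * _).
by have := ltn_ord s; have := ltn_ord t'; lia.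
Qed.

Let g w t (tau : int) : R[i] := (phi tau t 0)%:C * expi (tau%:~R * w).

Lemma predictor_sums_converge w t : sums_converge (g w t).
Proof.
apply: dominated_sums_converge (predictor_coef_summable t) _ => r.
by rewrite norm_real_expi.
Qed.

(** The reflected second summand of D runs over the times tau > n: the exponents
    agree because e^(i n omega_k) = 1. *)
Lemma Dmx_two_sided (k t : 'I_n) : Dmx Y n k t =
  rsqrtn n * (sum_le 0 (g (omega k) t) + sum_gt n%:Z (g (omega k) t)).
Proof.
pose h (tau : int) := (phi tau (rev_ord t) 0)%:C
  * expi (- ((tau - 1)%:~R * omega k)).
have ch : sums_converge h.
  apply: dominated_sums_converge (predictor_coef_summable (rev_ord t)) _ => r.
  by rewrite norm_real_expi.
rewrite mxE (sum_leD _ (predictor_sums_converge _ t) ch); congr (_ * (_ + _)).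
rewrite /sum_le /sum_gt.
suff -> : (fun j : nat => h (0 - j%:Z)) = (fun j => g (omega k) t (n%:Z + 1 + j%:Z)) by [].
apply/funext => j; rewrite /h /g.
have -> : n%:Z + 1 + j%:Z = n%:Z + 1 - (0 - j%:Z) by lia.
rewrite predictor_coef_reflect; congr (_ * _).
rewrite -[LHS]mul1r -(expi_omega_period k) -expiD; congr expi.
by rewrite !(rmorphB, rmorphD, rmorphN, rmorph1) /= -!pmulrn; ring.
Qed.

Lemma predictive_DFT_Dmx (X : 'cV[R]_n) (k : 'I_n) :
  (Dmx Y n *m map_mx (fun x => x%:C) X) k 0 = predictive_DFT Y X (omega k).
Proof.
rewrite mxE /predictive_DFT.
rewrite (_ : (fun tau : int => _) = (fun tau => \sum_t (X t 0)%:C * g (omega k) t tau)).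
  rewrite sum_le_sum; last by move=> t; exact: predictor_sums_converge.
  rewrite sum_gt_sum; last by move=> t; exact: predictor_sums_converge.
  rewrite -mulrDr -big_split mulr_sumr; apply: eq_bigr => t _.
  by rewrite Dmx_two_sided !mxE /=; ring.
apply/funext => tau; rewrite /predicted_obs rmorph_sum mulr_suml.
by apply: eq_bigr => t _; rewrite rmorphM /= /g; ring.
Qed.

(** The normal equations turn D Gamma into the sum of c(s - tau) e^(i tau w)
    over the unobserved times; F Gamma is the same sum over the observed ones.
    Together they are the Fourier series of f, shifted by s. *)
Lemma Fourier_Gamma_Dmx f : is_spectral_density f c ->
  (Fourier n + Dmx Y n) *m Gamma n c = Delta n f *m Fourier n.
Proof.
move=> fc; apply/matrixP => k s; rewrite mulmxDl mxE /Delta mul_diag_mx !mxE.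
pose w : R := omega k; pose a (tau : int) := (c (s.+1%:Z - tau))%:C * expi (tau%:~R * w).
have ca : sums_converge a.
  apply: dominated_sums_converge (summable_reflect s.+1%:Z c_summable) _ => r.
  by rewrite norm_real_expi.
have aE : a = (fun tau => \sum_(t < n) (c (s.+1%:Z - t.+1%:Z))%:C * g w t tau).
  apply/funext => tau; rewrite /a -normal_equations rmorph_sum mulr_suml.
  by apply: eq_bigr => t _; rewrite rmorphM /= /g; ring.
have -> : \sum_t Dmx Y n k t * Gamma n c t s =
    rsqrtn n * (sum_le 0 a + sum_gt n%:Z a).
  rewrite aE sum_le_sum; last by move=> t; exact: predictor_sums_converge.
  rewrite sum_gt_sum; last by move=> t; exact: predictor_sums_converge.
  rewrite -big_split mulr_sumr; apply: eq_bigr => t _.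
  rewrite Dmx_two_sided mxE -/w -(acov_even Y_series) opprB /=; ring.
have -> : \sum_t Fourier n k t * Gamma n c t s = rsqrtn n * \sum_(t < n) a t.+1%:Z.
  rewrite mulr_sumr; apply: eq_bigr => t _.
  by rewrite !mxE -(acov_even Y_series) opprB /a -pmulrn; ring.
have : (f w)%:C = sumZ (fun r => (c r)%:C * expi (r%:~R * w)) by exact: fc.
have cc : sums_converge (fun r => (c r)%:C * expi (r%:~R * w)).
  by apply: dominated_sums_converge c_summable _ => r; rewrite norm_real_expi.
move=> fwE; have : sumZ a = expi (s.+1%:R * w) * sumZ (fun r => (c r)%:C * expi (r%:~R * w)).
  rewrite -(sumZ_shift s.+1 ca) -(sumZM _ cc); congr sumZ; apply/funext => r.
  rewrite /a -(acov_even Y_series) opprB addrK rmorphD /= mulrDl expiD -pmulrn.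
  by ring.
rewrite (sumZ_window n ca) => E.
rewrite -/w fwE; move: E; set S := sumZ _ => E.
have -> : S * (rsqrtn n * expi (s.+1%:R * w)) = rsqrtn n * (expi (s.+1%:R * w) * S) by ring.
by rewrite -E; ring.
Qed.

End Predictors.

Theorem theorem2p2 (R : realType) (f : R -> R) (c : int -> R)
    (d : measure_display) (T : measurableType d) (P : probability T R)
    (Y : int -> {RV P >-> R}) (n : nat) (X : 'cV[R]_n)
    (n_gt0 : (0 < n)%N)
    (f_density : is_spectral_density f c)
    (f_bounded : bounded_away_from_zero f)
    (c_summable : (\esum_(r in [set: int]) (`|r%:~R * c r|)%:E < +oo)%E)
    (Y_series : zero_mean_series c Y) :
  [/\ Gamma n c \in unitmx,
      forall (tau : int) (phi : 'cV[R]_n), unobserved n tau ->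
        (best_linear_predictor Y tau phi <-> phi = predictor_coef Y n tau)
    & forall t : 'I_n,
        (\esum_(tau in unobserved n)
            (`|predictor_coef Y n tau t 0|)%:E < +oo)%E]
  /\
  [/\ gaussian_lik c X
        = n%:R^-1 * \sum_(k < n) complete_DFT Y X (omega k) * (DFT X (omega k))^*
                                 / (f (omega k))%:C,
      invmx (Gamma n c) - Circ n (fun w => (f w)^-1)
        = adjoint (Fourier n) *m Delta n (fun w => (f w)^-1) *m Dmx Y n,
      gaussian_lik c X - whittle_lik f X
        = n%:R^-1 * quadratic_form
                      (invmx (Gamma n c) - Circ n (fun w => (f w)^-1)) X
    & n%:R^-1 * quadratic_form
                  (invmx (Gamma n c) - Circ n (fun w => (f w)^-1)) X
        = n%:R^-1 * \sum_(k < n) predictive_DFT Y X (omega k) * (DFT X (omega k))^*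
                                 / (f (omega k))%:C].
Proof.
have sc := summable_acov c_summable.
have pd := acov_positive_definite (n := n) f_density f_bounded sc.
have Gu : Gamma n c \in unitmx.
  by rewrite Gamma_acov map_unitmx positive_definite_unit.
have f0 w : f w != 0.
  by have [delta d0 fd] := f_bounded; rewrite gt_eqF// (lt_le_trans d0).
pose W := adjoint (Fourier n) *m Delta n (fun w => (f w)^-1).
have GammaV : invmx (Gamma n c) = W *m (Fourier n + Dmx Y n).
  apply: (can_inj (mulmxK Gu)); rewrite mulVmx// -mulmxA
    (Fourier_Gamma_Dmx Y_series sc pd f_density).
  by rewrite /W mulmxA -[_ *m Delta n f]mulmxA DeltaV// mulmx1 Fourier_unitary.
have diffE : invmx (Gamma n c) - Circ n (fun w => (f w)^-1) = W *m Dmx Y n.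
  by rewrite GammaV mulmxDr /Circ addrC addKr.
have quadB (A B : 'M[R[i]]_n) : quadratic_form (A - B) X
    = quadratic_form A X - quadratic_form B X.
  by rewrite /quadratic_form mulmxBr mulmxBl !mxE.
split.
  split=> // [tau phi _|t].
    rewrite (predictor_coefE Y_series)//.
    exact: (best_linear_predictorP Y_series).
  apply: le_lt_trans (predictor_coef_summable Y_series sc pd t).
  rewrite esum_mkcond; apply: le_esum => r _ /=.
  by case: ifP.
split=> //.
- rewrite /gaussian_lik GammaV quadratic_form_Fourier; congr (_ * _).
  apply: eq_bigr => k _; rewrite fmorphV; congr (_ * _ / _).
  by rewrite mulmxDl mxE mulmx_Fourier (predictive_DFT_Dmx Y_series).
- by rewrite /gaussian_lik /whittle_lik quadB mulrBr.
- rewrite diffE quadratic_form_Fourier; congr (_ * _).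
  apply: eq_bigr => k _; rewrite fmorphV; congr (_ * _ / _).
  by rewrite (predictive_DFT_Dmx Y_series).
Qed.
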